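(* Let $k$ be a positive integer and let $\varepsilon_1,\ldots,\varepsilon_k$ be nonnegative real numbers with $\varepsilon_1+\cdots+\varepsilon_k=1$. If $G$ is a graph in which every vertex has even degree, then $G$ can be edge-decomposed into $k$ even factors $G_1,\ldots,G_k$ such that for each $i$ and each vertex $v$, $|d_{G_i}(v)-\varepsilon_i d_G(v)|<6$.
   Context: Graphs are finite and may have loops and multiple edges; a loop contributes $2$ to the degree. An even factor is a spanning subgraph in which every vertex has even degree. ''Edge-decomposed into factors'' means the edge set is partitioned into the edge sets of spanning subgraphs. *)

(* Defs.v *)
From HB Require Import structures.
From mathcomp Require Import all_boot all_order all_algebra.
From mathcomp Require Import reals.
Set Implicit Arguments.
Unset Strict Implicit.
Unset Printing Implicit Defensive.

(* Finite graphs with loops and multiple edges.  The two ends of an edge are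
   listed in an arbitrary order, which no definition below depends on; an edge
   is a loop when its two ends coincide. *)
Record multigraph := MultiGraph {
  vertex : finType;
  edge : finType;
  end1 : edge -> vertex;
  end2 : edge -> vertex
}.

(* A factor (spanning subgraph) contains every vertex, so it is identified with
   its edge set [F].  Each edge is counted once per end at [v], so a loop at
   [v] counts twice. *)
Definition factor_degree (G : multigraph) (F : {set edge G}) (v : vertex G)
    : nat :=
  \sum_(e in F) ((end1 e == v) + (end2 e == v)).

Definition degree (G : multigraph) (v : vertex G) : nat :=
  factor_degree [set: edge G] v.

Definition even_factor (G : multigraph) (F : {set edge G}) : Prop :=
  forall v : vertex G, ~~ odd (factor_degree F v).

(* Unlike in [finset.partition], the parts are indexed and may be empty. *)
Definition edge_decomposition (G : multigraph) (k : nat)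
    (F : 'I_k -> {set edge G}) : Prop :=
  \bigcup_(i < k) F i = [set: edge G] /\
  (forall i j : 'I_k, i != j -> [disjoint F i & F j]).

(* Main.v *)
(** A [0, 1]-valued flow with integral excesses can be rounded to a 0/1 flow with
    the same excesses.  Rounding the constant flow 1/2 orients an even graph
    with equal in- and out-degrees; rounding the constant flow [c], with the
    flow through each vertex as well, then yields an even factor [F] of an even
    graph [H] with [|d_F - c d_H| < 2].

    For [k] colours, such splittings are iterated along a binary tree.  As long
    as two weights differ by a factor at most 2 they are merged, and splitting
    the merged class [|d - (a + b) f| < 6] gives errors below
    [2/3 * 6 + 2 = 6].  Once the weights are lacunary (each more than twice the
    next), the colours are split off from the heaviest to the lightest. *)
Require Import Defs.
From HB Require Import structures.
From mathcomp Require Import all_boot all_order all_algebra.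
From mathcomp Require Import reals ring lra zify.
Set Implicit Arguments.
Unset Strict Implicit.
Unset Printing Implicit Defensive.
Import Order.TTheory GRing.Theory Num.Theory.
Local Open Scope ring_scope.

(** * Circulations and the rounding of flows *)

Definition excess (R : pzRingType) (N A : finType) (s t : A -> N) (x : A -> R)
    (v : N) : R :=
  \sum_a x a * ((s a == v)%:R - (t a == v)%:R).

(** Every vertex met by [D] meets at least two arc ends of [D], so counting ends twice gives at most
    as many such vertices as arcs. This is enough for a linear dependency, since the incidence
    matrix never has full column rank. *)
Lemma circulation_on_support (R : realFieldType) (N A : finType) (s t : A -> N)
    (D : {set A}) :
    D != set0 ->
    (forall v, (\sum_(a in D) ((s a == v) + (t a == v)))%N != 1%N) ->
  exists z : A -> R, [/\ exists a, z a != 0, forall a, a \notin D -> z a = 0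
    & forall v, excess s t z v = 0].
Proof.
move=> /set0Pn[a0 a0D] deg1.
pose V := [set s a | a in D] :|: [set t a | a in D].
have sV a : a \in D -> s a \in V by move=> aD; rewrite inE imset_f.
have tV a : a \in D -> t a \in V by move=> aD; rewrite inE imset_f ?orbT.
have leVD : (#|V| <= #|D|)%N.
  suff: (\sum_(v in V) 2 <= \sum_(a in D) 2)%N.
    by rewrite !sum_nat_const leq_pmul2r.
  have -> : (\sum_(a in D) 2 =
             \sum_(v in V) \sum_(a in D) ((s a == v) + (t a == v)))%N.
    rewrite exchange_big /=; apply: eq_bigr => a aD.
    rewrite big_split /= -!big_mkcondr /=.
    rewrite (big_pred1 (s a)) => [|v]; last first.
      by rewrite /= eq_sym; case: eqP => [->|]; rewrite ?sV ?andbF.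
    rewrite (big_pred1 (t a)) // => v.
    by rewrite /= eq_sym; case: eqP => [->|]; rewrite ?tV ?andbF.
  apply: leq_sum => v vV; have := deg1 v.
  have: (0 < \sum_(a in D) ((s a == v) + (t a == v)))%N.
    move: vV; rewrite inE => /orP[] /imsetP[a aD ->];
      by rewrite (bigD1 a) //= eqxx ?addnS.
  by case: (\sum_(a in D) _)%N => [|[|]].
(* The rows of the incidence matrix sum to 0, so its rank is less than
   [#|V| <= #|D|] and its rows are dependent. *)
pose M : 'M[R]_(#|D|, #|V|) := \matrix_(i, j)
  ((s (enum_val i) == enum_val j)%:R - (t (enum_val i) == enum_val j)%:R).
have V_gt0 : (0 < #|V|)%N by apply/card_gt0P; exists (s a0); apply: sV.
have sum_V u : u \in V -> \sum_(j < #|V|) (u == enum_val j)%:R = 1 :> R.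
  move=> uV; rewrite -(big_enum_val (fun v => (u == v)%:R)) /=.
  by rewrite -natr_sum -big_mkcondr /= (big_pred1 u) // => v /=;
    rewrite eq_sym; case: eqP => [->|]; rewrite ?uV ?andbF.
have M1 : M *m (const_mx 1 : 'cV_#|V|) = 0.
  apply/matrixP => i j; rewrite !mxE.
  under eq_bigr do rewrite !mxE mulr1.
  by rewrite sumrB !sum_V ?subrr //; [apply: tV|apply: sV]; apply: enum_valP.
have rkM : (\rank M < #|V|)%N.
  rewrite ltn_neqAle rank_leq_col andbT; apply/negP => fullM.
  have := M1; rewrite -[RHS](mulmx0 _ M) => /(row_full_inj fullM).
  move=> /matrixP/(_ (Ordinal V_gt0) 0)/eqP.
  by rewrite !mxE oner_eq0.
have: kermx M != 0.
  by rewrite kermx_eq0 /row_free neq_ltn (leq_trans rkM leVD).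
move=> /rowV0Pn[u /sub_kermxP uM u0].
pose z a := if a \in D =P true is ReflectT aD then u 0 (enum_rank_in aD a) else 0.
have zE i : z (enum_val i) = u 0 i.
  rewrite /z; case: eqP => [aD|]; last by rewrite enum_valP.
  by rewrite enum_valK_in.
have zD a : a \notin D -> z a = 0.
  by move=> aD; rewrite /z; case: eqP => // aD'; case/negP: aD.
exists z; split => // [|v].
  by have /rV0Pn[i ui] := u0; exists (enum_val i); rewrite zE.
rewrite /excess (bigID (fun a => a \in D)) /= [X in _ + X]big1 ?addr0; last first.
  by move=> a /zD ->; rewrite mul0r.
have [vV|vV] := boolP (v \in V); last first.
  rewrite big1 // => a aD.
  by do 2?[case: eqP vV => [<-|_ vV]; first by rewrite ?sV ?tV]; rewrite subrr mulr0.
have /matrixP/(_ 0 (enum_rank_in vV v)) := uM.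
rewrite !mxE => uMv; rewrite -[RHS]uMv.
rewrite (big_enum_val (fun a => z a * ((s a == v)%:R - (t a == v)%:R))) /=.
by apply: eq_bigr => i _; rewrite !mxE zE enum_rankK_in.
Qed.

Lemma excess_shift (R : comPzRingType) (N A : finType) (s t : A -> N)
    (x z : A -> R) (c : R) (v : N) :
  excess s t (fun a => x a + c * z a) v = excess s t x v + c * excess s t z v.
Proof.
rewrite /excess mulr_sumr -big_split /=; apply: eq_bigr => a _.
by rewrite mulrDl mulrA.
Qed.

Lemma not_int01 (R : archiRealFieldType) (x : R) :
  0 < x < 1 -> x \isn't a Num.int.
Proof.
move=> x01; apply/negP => /intrP[m xm]; move: x01.
by rewrite xm ltr0z ltrz1; lia.
Qed.

(** Induction on the number of fractional arcs: a circulation supported on them changes no excess,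
    and pushing along it makes one of them integral while arcs already at 0 or 1 stay put. *)
Lemma flow_rounding (R : archiRealFieldType) (N A : finType) (s t : A -> N)
    (x : A -> R) :
    (forall a, 0 <= x a <= 1) ->
    (forall v, excess s t x v \is a Num.int) ->
  exists S : {set A}, [/\ forall a, x a = 1 -> a \in S,
    forall a, x a = 0 -> a \notin S
    & forall v, excess s t (fun a => (a \in S)%:R) v = excess s t x v].
Proof.
have [n] := ubnP #|[set a | 0 < x a < 1]|.
elim: n x => // n IHn x; set D := [set a | _]; rewrite ltnS => leDn x01 intx.
have xND a : a \notin D -> x a = 0 \/ x a = 1.
  rewrite inE; have /andP[] := x01 a; rewrite !le_eqVlt.
  case/orP=> [/eqP|] ->; first by left.
  by case/orP=> [/eqP|] ->; [right|].
have [D0|D0] := eqVneq D set0.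
  exists [set a | x a == 1]; split=> [a xa1|a xa0|v].
  - by rewrite inE xa1.
  - by rewrite inE xa0 eq_sym oner_eq0.
  - apply: eq_bigr => a _; congr (_ * _); rewrite inE.
    by case: (xND a) => [|->|->]; rewrite ?D0 ?inE ?eqxx // eq_sym oner_eq0.
(* If a single fractional arc end met [v], all other terms of the excess would be integers, and the
   integral excess would force that arc to be integral. *)
have deg1 v : (\sum_(a in D) ((s a == v) + (t a == v)))%N != 1%N.
  apply/eqP => sum1.
  have [a aD n0] : exists2 a, a \in D & ((s a == v) + (t a == v) != 0)%N.
    apply/exists_inP; apply: contra_eqT sum1 => /exists_inPn n0.
    by rewrite big1 // => a /n0 /negPn/eqP.
  move: sum1; rewrite (bigD1 a) //= => sum1.
  have /eqP : (\sum_(b in D | b != a) ((s b == v) + (t b == v)) = 0)%N by lia.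
  rewrite sum_nat_eq0 => /forallP others.
  have := intx v; rewrite /excess (bigD1 a) //= rpredDr; last first.
    apply: rpred_sum => b ba; have [bD|/xND[]->] := boolP (b \in D).
    - have := others b; rewrite bD ba /= addn_eq0 !eqb0.
      by case/andP=> /negPf-> /negPf->; rewrite subrr mulr0 rpred0.
    - by rewrite mul0r rpred0.
    - by rewrite mul1r rpredB ?rpred_nat.
  have := not_int01 (_ : 0 < x a < 1); move: (aD); rewrite inE => -> /(_ isT).
  move: n0 sum1; case: (s a == v); case: (t a == v) => //= _ _ /negPf xa.
    by rewrite subr0 mulr1 xa.
  by rewrite sub0r mulrN1 rpredN xa.
(* Moving along the circulation [z] until some fractional arc becomes integral. *)
have [z [[a0 za0] zD zcirc]] := circulation_on_support R D0 deg1.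
(* [r a] is the step length at which arc [a] hits its bound: 1 if its flow increases, 0 if it
   decreases. The minimum over the support of [z] is the first hit, so no arc leaves the unit
   interval. *)
pose r a := if 0 < z a then (1 - x a) / z a else x a / - z a.
have [a za min_a] := @arg_minP _ _ _ a0 (fun a => z a != 0) r za0.
pose y b := x b + r a * z b.
have zneg b : z b != 0 -> 0 < z b = false -> 0 < - z b.
  by move=> zb0 zb; rewrite oppr_gt0 lt_neqAle zb0 leNgt zb.
have r_ge0 : 0 <= r a.
  have /andP[x0 x1] := x01 a.
  rewrite /r; case: ifP => za'; first by rewrite divr_ge0 ?subr_ge0 // ltW.
  by rewrite divr_ge0 // ltW // zneg.
have y01 b : 0 <= y b <= 1.
  have /andP[x0 x1] := x01 b; rewrite /y.
  have [->|zb0] := eqVneq (z b) 0; first by rewrite mulr0 addr0 x0.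
  have := min_a b zb0; rewrite {2}/r; case: ifP => zb.
    rewrite ler_pdivlMr // => le_r; apply/andP; split; last lra.
    by rewrite addr_ge0 // mulr_ge0 // ltW.
  have zb' := zneg _ zb0 zb.
  rewrite ler_pdivlMr // => le_r; apply/andP; split; first lra.
  have : 0 <= r a * - z b by rewrite mulr_ge0 // ltW.
  lra.
have ya : y a = 0 \/ y a = 1.
  rewrite /y /r; case: ifP => za'; [right|left].
    by rewrite divfK // subrKC.
  by rewrite invrN mulrN mulNr divfK // subrr.
have yx v : excess s t y v = excess s t x v.
  by rewrite /y excess_shift zcirc mulr0 addr0.
have yND b : b \notin D -> y b = x b.
  by move=> /zD zb; rewrite /y zb mulr0 addr0.
have [|//|v|S [S1 S0 Sy]] := IHn y.
- apply: leq_trans leDn; apply: proper_card; apply/properP; split.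
    apply/subsetP => b; rewrite inE => yb; apply: contraT => bD.
    by move: yb; rewrite yND //; case: (xND b bD) => ->; rewrite ltxx ?andbF.
  exists a; first by apply: contraNT za => /zD ->.
  by rewrite inE; case: ya => ->; rewrite ltxx ?andbF.
- by rewrite yx.
- exists S; split=> [b xb|b xb|v]; last by rewrite Sy yx.
  + by apply: S1; rewrite yND // inE xb ltxx andbF.
  + by apply: S0; rewrite yND // inE xb ltxx.
Qed.

(** * Balanced orientations and splitting an even graph in two *)

Lemma eulerian_orientation (G : multigraph) (H : {set edge G}) :
    even_factor H ->
  exists tail head : edge G -> vertex G,
    (forall F v, factor_degree F v =
       \sum_(e in F) (tail e == v) + \sum_(e in F) (head e == v))%N /\
    (forall v, \sum_(e in H) (tail e == v) = \sum_(e in H) (head e == v))%N.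
Proof.
move=> evH.
pose x (e : edge G) : rat := if e \in H then 1 / 2 else 0.
have x01 e : 0 <= x e <= 1 by rewrite /x; case: ifP => _; lra.
have intx v : excess (@end1 G) (@end2 G) x v \is a Num.int.
  (* The half flow has as excess the number of first ends minus half the degree, an integer because
     the degree is even. *)
  have -> : excess (@end1 G) (@end2 G) x v =
      (\sum_(e in H) (end1 e == v))%:R - (factor_degree H v)./2%:R.
    have: (factor_degree H v)%:R = 2 * (factor_degree H v)./2%:R :> rat.
      by rewrite -natrM mul2n even_halfK.
    rewrite /factor_degree big_split natrD !natr_sum /= => half.
    have -> : excess (@end1 G) (@end2 G) x v =
        \sum_(e in H) 1 / 2 * ((end1 e == v)%:R - (end2 e == v)%:R).
      rewrite [RHS]big_mkcond; apply: eq_bigr => e _.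
      by rewrite /x; case: ifP; rewrite ?mul0r.
    rewrite -mulr_sumr sumrB; lra.
  by rewrite rpredB ?rpred_nat.
have [S [_ S0 Sx]] := flow_rounding x01 intx.
pose tail e := if e \in S then end1 e else end2 e.
pose head e := if e \in S then end2 e else end1 e.
exists tail, head; split=> v.
  move=> u; rewrite -big_split; apply: eq_bigr => e _ /=.
  by rewrite /tail /head; case: ifP => // _; rewrite addnC.
apply: (mulrIn (oner_neq0 rat)); apply/eqP; rewrite -subr_eq0 !natr_sum -sumrB.
(* Edges rounded to 0 are reversed: on [H], twice the change from 1/2 is 1 for a kept edge and -1
   for a reversed one, so equal excesses mean balance. *)
suff -> : \sum_(e in H) ((tail e == v)%:R - (head e == v)%:R) =
    2 * (excess (@end1 G) (@end2 G) (fun e => (e \in S)%:R) v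
         - excess (@end1 G) (@end2 G) x v) :> rat by rewrite Sx subrr mulr0.
rewrite -sumrB mulr_sumr big_mkcond; apply: eq_bigr => e _.
have := S0 e; rewrite /x /tail /head; case: (e \in H) => [_|/(_ erefl)/negPf->].
  by case: (e \in S) => /=; lra.
by rewrite mul0r subrr mulr0.
Qed.

(* Splitting each vertex [v] into an in-copy [(v, false)] and an out-copy
   [(v, true)] joined by an arc turns the out-degree at [v] into the flow on
   that arc. *)
Lemma even_factor_split (R : archiRealFieldType) (G : multigraph)
    (H : {set edge G}) (c : R) :
    even_factor H -> 0 <= c <= 1 ->
  exists F : {set edge G}, [/\ F \subset H, even_factor F &
    forall v, `|(factor_degree F v)%:R - c * (factor_degree H v)%:R| < 2].
Proof.
move=> evH c01; have [tail [head [degE balH]]] := eulerian_orientation evH.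
pose s (a : edge G + vertex G) :=
  match a with inl e => (tail e, true) | inr v => (v, false) end.
pose t (a : edge G + vertex G) :=
  match a with inl e => (head e, false) | inr v => (v, true) end.
pose m v := (\sum_(e in H) (tail e == v))%N.
(* The arc from in-copy to out-copy carries only the fractional part of the flow [c * m v] through
   [v]; the floor becomes the excess, which is thus integral and opposite at the two copies. *)
pose fl v : R := (Num.floor (c * (m v)%:R))%:~R.
pose x (a : edge G + vertex G) : R :=
  match a with inl e => if e \in H then c else 0
             | inr v => c * (m v)%:R - fl v end.
have excess_out y v : excess s t y (v, true) =
    \sum_e y (inl e) * (tail e == v)%:R - y (inr v) :> R.
  rewrite /excess big_sumType /=; congr (_ + _).
    by apply: eq_bigr => e _; rewrite !xpair_eqE andbT andbF subr0.
  rewrite (bigD1 v) //= !xpair_eqE eqxx andbF sub0r mulrN1 big1 ?addr0 // => u.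
  by rewrite !xpair_eqE andbT andbF => /negPf ->; rewrite subrr mulr0.
have excess_in y v : excess s t y (v, false) =
    y (inr v) - \sum_e y (inl e) * (head e == v)%:R :> R.
  rewrite /excess big_sumType /= addrC -sumrN; congr (_ + _).
    rewrite (bigD1 v) //= !xpair_eqE eqxx andbF subr0 mulr1 big1 ?addr0 // => u.
    by rewrite !xpair_eqE andbT andbF => /negPf ->; rewrite subrr mulr0.
  by apply: eq_bigr => e _; rewrite !xpair_eqE andbT andbF sub0r mulrN.
have sum_x (h : edge G -> vertex G) v :
    \sum_e x (inl e) * (h e == v)%:R = c * (\sum_(e in H) (h e == v))%N%:R.
  rewrite natr_sum mulr_sumr [RHS]big_mkcond; apply: eq_bigr => e _.
  by rewrite /=; case: ifP; rewrite ?mul0r.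
have excess_x v b : excess s t x (v, b) = if b then fl v else - fl v.
  case: b; rewrite ?excess_out ?excess_in sum_x -?balH /x /m; lra.
have x01 a : 0 <= x a <= 1.
  case: a => [e|v] /=; first by case: ifP => // _; rewrite lexx ler01.
  have := floor_itv (c * (m v)%:R); rewrite intrD -/(fl v); lra.
have intx u : excess s t x u \is a Num.int.
  by case: u => v b; rewrite excess_x; case: b; rewrite ?rpredN intr_int.
have [S [_ S0 Sx]] := flow_rounding x01 intx.
pose F := [set e | inl e \in S].
have sum_S (h : edge G -> vertex G) v :
    \sum_e (inl e \in S)%:R * (h e == v)%:R = (\sum_(e in F) (h e == v))%N%:R :> R.
  rewrite natr_sum [RHS]big_mkcond; apply: eq_bigr => e _.
  by rewrite inE; case: ifP; rewrite ?mul0r ?mul1r.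
have outF v : (\sum_(e in F) (tail e == v))%N%:R = fl v + (inr v \in S)%:R :> R.
  have := Sx (v, true); rewrite excess_x excess_out sum_S; lra.
have balF v : (\sum_(e in F) (tail e == v) = \sum_(e in F) (head e == v))%N.
  apply: (mulrIn (oner_neq0 R)); rewrite outF.
  have := Sx (v, false); rewrite excess_x excess_in sum_S; lra.
exists F; split=> [|v|v].
- apply/subsetP => e; rewrite inE; apply: contraLR => eH.
  by apply: S0; rewrite /= (negPf eH).
- by rewrite degE -balF addnn odd_double.
(* The degree in [F] is twice the floor of [c * m v], plus 2 if the arc of [v] is rounded up. An
   error of exactly 2 would need rounding up an integral [c * m v], but then the arc carries 0 and
   is not selected. *)
- rewrite !degE -balF -balH -/(m v) !natrD outF.
  have := floor_itv (c * (m v)%:R); rewrite intrD -/(fl v).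
  have : inr v \in S -> c * (m v)%:R != fl v.
    by apply: contraL => /eqP xv; apply: S0; rewrite /= xv subrr.
  case: (inr v \in S) => /= [/(_ isT)|_]; rewrite ltr_norml; last lra.
  by rewrite neq_lt => /orP[]; lra.
Qed.

(** * Colourings with prescribed weights *)

Lemma factor_degreeD (G : multigraph) (F H : {set edge G}) (v : vertex G) :
    F \subset H ->
  factor_degree H v = (factor_degree F v + factor_degree (H :\: F) v)%N.
Proof.
by move=> FH; rewrite /factor_degree (big_setID F) /= (setIidPr FH).
Qed.

Lemma even_factorD (G : multigraph) (F H : {set edge G}) :
  F \subset H -> even_factor H -> even_factor F -> even_factor (H :\: F).
Proof.
move=> FH evH evF v; have := evH v.
by rewrite (factor_degreeD v FH) oddD (negPf (evF v)).
Qed.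

Lemma ltr_norm_scaleD (R : realDomainType) (r x y a b : R) :
  0 <= r -> `|x| <= a -> `|y| < b -> `|r * x + y| < r * a + b.
Proof.
move=> r0 xa yb; apply: le_lt_trans (ler_normD _ _) _.
by rewrite normrM (ger0_norm r0) ler_ltD // ler_wpM2l.
Qed.

Definition color_class (G : multigraph) (I : eqType) (H : {set edge G})
    (col : edge G -> I) (i : I) : {set edge G} :=
  [set e in H | col e == i].

(** The target [f] stays fixed while colours are merged or split off, so errors are always measured
    against the original degrees. *)
Definition approx_coloring (R : numDomainType) (G : multigraph) (I : finType)
    (w : I -> R) (f : vertex G -> R) (A : {set I}) (H : {set edge G})
    (col : edge G -> I) : Prop :=
  (forall e, e \in H -> col e \in A) /\
  (forall i, i \in A -> even_factor (color_class H col i) /\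
     forall v, `|(factor_degree (color_class H col i) v)%:R - w i * f v| < 6).

(* Splitting off the heaviest colour keeps the error at most [4 * W / w j],
   where [W] is the remaining weight, for every remaining colour [j]. *)
Lemma lacunary_coloring (R : archiRealFieldType) (G : multigraph) (I : finType)
    (w : I -> R) (f : vertex G -> R) (A : {set I}) (H : {set edge G}) :
    even_factor H -> A != set0 ->
    (forall i, i \in A -> 0 < w i) ->
    {in A &, forall i j, i != j -> 2 * w i < w j \/ 2 * w j < w i} ->
    (forall j v, j \in A ->
       `|(factor_degree H v)%:R - (\sum_(i in A) w i) * f v|
         <= 4 * (\sum_(i in A) w i) / w j) ->
  exists col, approx_coloring w f A H col.
Proof.
have [n] := ubnP #|A|; elim: n A H => // n IHn A H.
rewrite ltnS => leAn evH /set0Pn[i1 i1A] w_gt0 lacA errH.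
have [i iA max_i] := @arg_maxP _ _ _ i1 (fun i => i \in A) w i1A.
have wi := w_gt0 i iA.
set W := \sum_(i in A) w i in errH.
pose A' := A :\ i; pose W' := \sum_(j in A') w j.
have WE : W = w i + W' by rewrite /W (big_setD1 i).
have W'_ge j : j \in A' -> w j <= W'.
  move=> jA'; rewrite /W' (bigD1 j) //= lerDl sumr_ge0 // => l.
  by rewrite 2!inE => /andP[/andP[_ lA] _]; rewrite ltW ?w_gt0.
have W'0 : 0 <= W'.
  by apply: sumr_ge0 => j; rewrite !inE => /andP[_ jA]; rewrite ltW ?w_gt0.
have W0 : 0 < W by lra.
have r01 : 0 <= w i / W <= 1.
  by rewrite ler_pdivrMr // divr_ge0 ?(ltW wi) ?(ltW W0) //; lra.
have [F [FH evF errF]] := even_factor_split evH r01.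
have errF6 v : `|(factor_degree F v)%:R - w i * f v| < 6.
  have -> : (factor_degree F v)%:R - w i * f v =
      w i / W * ((factor_degree H v)%:R - W * f v)
      + ((factor_degree F v)%:R - w i / W * (factor_degree H v)%:R).
    by field; rewrite gt_eqF.
  (* The inherited error, scaled by [w i / W], is at most 4, and the split adds less than 2. *)
  have /andP[r0 _] := r01.
  apply: lt_le_trans (ltr_norm_scaleD r0 (errH i v iA) (errF v)) _.
  have -> : w i / W * (4 * W / w i) = 4 by field; rewrite !gt_eqF.
  lra.
have [A'0|A'0] := eqVneq A' set0.
  exists (fun=> i); split=> [//|j jA].
  have -> : j = i.
    by apply/eqP; apply: contraT => ji; have := in_set0 j; rewrite -A'0 !inE ji jA.
  have -> : color_class H (fun=> i) i = H by apply/setP => e; rewrite inE eqxx andbT.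
  split=> // v; apply: le_lt_trans (_ : 4 < 6); last lra.
  have := errH i v iA; rewrite WE /W' A'0 big_set0 addr0 mulfK ?gt_eqF //.
have A'A j : j \in A' -> j \in A /\ j != i by rewrite !inE => /andP[].
case: (IHn A' (H :\: F)) => [|||l lA'|l l' lA lA' ll'|j v jA'|col [colA' colP]].
- by rewrite (cardsD1 i) iA in leAn.
- exact: even_factorD.
- by [].
- by apply: w_gt0; case: (A'A _ lA').
- by apply: lacA => //; [case: (A'A _ lA)|case: (A'A _ lA')].
- have [jA ji] := A'A j jA'; have wj := w_gt0 j jA.
  have w2 : 2 * w j <= w i.
    by case: (lacA j i jA iA ji) => [/ltW//|]; have /= := max_i j jA; lra.
  have -> : (factor_degree (H :\: F) v)%:R - W' * f v =
      W' / W * ((factor_degree H v)%:R - W * f v)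
      + (w i / W * (factor_degree H v)%:R - (factor_degree F v)%:R).
    rewrite (factor_degreeD v FH) natrD WE; field.
    by rewrite -WE gt_eqF.
  have := errF v; rewrite distrC => err.
  apply: ltW; apply: lt_le_trans (ltr_norm_scaleD _ (errH i v iA) err) _.
    by rewrite divr_ge0 // ltW.
  have -> : W' / W * (4 * W / w i) + 2 = (4 * W' + 2 * w i) / w i.
    by field; rewrite !gt_eqF.
  (* The invariant for the remainder: [2 * w j <= w i] and [w j <= W'] bound both [4 * W' * w j] and
     [2 * w i * w j] by [2 * W' * w i]. *)
  rewrite ler_pdivrMr // mulrAC ler_pdivlMr // -/W'.
  have := ler_wpM2l W'0 w2; have := ler_wpM2l (ltW wi) (W'_ge j jA'); lra.
exists (fun e => if e \in F then i else col e); split=> [e eH|j jA].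
  case: ifP => // eF; apply: (proj1 (A'A _ (colA' e _))).
  by rewrite inE eF.
have [->|ji] := eqVneq j i.
  suff -> : color_class H (fun e => if e \in F then i else col e) i = F by [].
  apply/setP => e; rewrite inE; have [eF|eF] := boolP (e \in F).
    by rewrite eqxx (subsetP FH).
  apply/negP => /andP[eH /eqP ei]; have := colA' e.
  by rewrite inE eF eH ei => /(_ isT)/A'A[_]; rewrite eqxx.
suff -> : color_class H (fun e => if e \in F then i else col e) j
    = color_class (H :\: F) col j by apply: colP; rewrite !inE ji.
apply/setP => e; rewrite !inE; case: (e \in F) => //=.
by rewrite eq_sym (negPf ji) andbF.
Qed.

(* Two colours whose weights differ by a factor at most 2 are merged: splitting
   the merged class turns an error below 6 into one below 2 / 3 * 6 + 2 = 6. *)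
Lemma proportional_coloring (R : archiRealFieldType) (G : multigraph)
    (I : finType) (w : I -> R) (f : vertex G -> R) (A : {set I})
    (H : {set edge G}) :
    even_factor H -> A != set0 ->
    (forall i, i \in A -> 0 < w i) ->
    (forall v, (factor_degree H v)%:R = (\sum_(i in A) w i) * f v) ->
  exists col, approx_coloring w f A H col.
Proof.
have [n] := ubnP #|A|; elim: n A w => // n IHn A w.
rewrite ltnS => leAn evH A0 w_gt0 degH.
have [close|lac] := boolP [exists i in A, exists j in A,
  [&& i != j, w i <= 2 * w j & w j <= 2 * w i]]; last first.
  (* Without a close pair the weights are lacunary, and the initial error is 0 by [degH]. *)
  apply: lacunary_coloring => //.
    move=> i j iA jA ij; move/exists_inPn: lac => /(_ i iA)/exists_inPn/(_ j jA).
    by rewrite ij /= negb_and -!ltNge => /orP[]; [right|left].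
  move=> j v jA; rewrite degH subrr normr0 divr_ge0 //; last first.
    by rewrite ltW ?w_gt0.
  by rewrite mulr_ge0 // sumr_ge0 // => i iA; rewrite ltW ?w_gt0.
have /exists_inP[i iA /exists_inP[j jA /and3P[ij wij wji]]] := close.
have [wi wj] := (w_gt0 i iA, w_gt0 j jA).
(* Colour [i] stands for the merged pair and [j] is retired, which preserves the total weight;
   afterwards [F] keeps colour [i] and the rest of the merged class gets [j]. *)
pose w' l := if l == i then w i + w j else w l.
pose A' := A :\ j.
have iA' : i \in A' by rewrite !inE ij.
have sumA' : \sum_(l in A') w' l = \sum_(l in A) w l.
  rewrite [RHS](big_setD1 j) //= [RHS]addrC.
  rewrite (big_setD1 i iA') [in RHS](big_setD1 i iA') /=.
  rewrite /w' eqxx addrAC; congr (_ + _ + _).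
  by apply: eq_bigr => l; rewrite !inE => /andP[/negPf->].
have [||||v|col [colA' colP]] := IHn A' w'.
- by rewrite (cardsD1 j) jA in leAn.
- by [].
- by apply/set0Pn; exists i.
- move=> l; rewrite !inE /w' => /andP[_ lA].
  by case: ifP => _; [apply: addr_gt0|apply: w_gt0].
- by rewrite sumA'.
have [evK errK] := colP i iA'; set K := color_class H col i in evK errK.
have KH : K \subset H by apply/subsetP => e; rewrite inE => /andP[].
pose W := w i + w j; have W0 : 0 < W by apply: addr_gt0.
have errKW v : `|(factor_degree K v)%:R - W * f v| <= 6.
  by have := errK v; rewrite /w' eqxx => /ltW.
have r01 : 0 <= w i / W <= 1.
  by rewrite ler_pdivrMr // divr_ge0 ?(ltW wi) ?(ltW W0) // /W; lra.
have [F [FK evF errF]] := even_factor_split evK r01.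
pose col' e := if e \in K :\: F then j else col e.
have colj e : e \in H -> col e != j by move=> /colA'; rewrite !inE => /andP[].
have clj : color_class H col' j = K :\: F.
  apply/setP => e; rewrite inE /col'; case: ifP => eKF.
    by rewrite eqxx andbT (subsetP KH) //; move: eKF; rewrite inE => /andP[].
  by apply/negP => /andP[/colj/negP].
have cli : color_class H col' i = F.
  apply/setP => e; rewrite inE /col'; have [eF|eF] := boolP (e \in F).
    by have := subsetP FK e eF; rewrite !inE eF.
  rewrite inE eF /=; case: ifP => [|]; first by rewrite eq_sym (negPf ij) andbF.
  by rewrite inE.
have cll l : l != i -> l != j -> color_class H col' l = color_class H col l.
  move=> li lj; apply/setP => e; rewrite !inE /col'; case: ifP => //.
  rewrite !inE => /and3P[_ _ /eqP->].
  by rewrite eq_sym (negPf lj) eq_sym (negPf li).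
(* Here [r] is the share of [i] or [j] in the merged weight, at most 2/3 because neither weight
   exceeds twice the other. *)
have split_err r x y : 0 <= r -> 3 * r <= 2 -> `|x| <= 6 -> `|y| < 2 ->
    `|r * x + y| < 6 :> R.
  move=> r0 r23 x6 y2; apply: lt_le_trans (ltr_norm_scaleD r0 x6 y2) _; lra.
exists col'; split=> [e eH|l lA].
  rewrite /col'; case: ifP => // _.
  by have := colA' e eH; rewrite inE => /andP[].
have [->|li] := eqVneq l i.
  rewrite cli; split=> // v.
  have -> : (factor_degree F v)%:R - w i * f v =
      w i / W * ((factor_degree K v)%:R - W * f v)
      + ((factor_degree F v)%:R - w i / W * (factor_degree K v)%:R).
    by field; rewrite gt_eqF.
  apply: split_err => //; first by case/andP: r01.
  by rewrite mulrA ler_pdivrMr // /W; lra.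
have [->|lj] := eqVneq l j.
  rewrite clj; split=> [|v]; first exact: even_factorD.
  have -> : (factor_degree (K :\: F) v)%:R - w j * f v =
      w j / W * ((factor_degree K v)%:R - W * f v)
      + (w i / W * (factor_degree K v)%:R - (factor_degree F v)%:R).
    rewrite (factor_degreeD v FK) natrD /W; field.
    by rewrite -/W gt_eqF.
  apply: split_err => //; last by rewrite distrC.
    by rewrite divr_ge0 // ltW.
  by rewrite mulrA ler_pdivrMr // /W; lra.
have := colP l; rewrite !inE lj lA (cll l li lj) /w' (negPf li).
by apply.
Qed.

Theorem theorem5p14 (R : realType) (k : nat) (hk : (0 < k)%N)
  (eps : 'I_k -> R) (eps_ge0 : forall i : 'I_k, 0 <= eps i)
  (eps_sum : \sum_(i < k) eps i = 1)
  (G : multigraph) (G_even : forall v : vertex G, ~~ odd (degree v)) :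
  exists F : 'I_k -> {set edge G},
    edge_decomposition F /\
    (forall i : 'I_k, even_factor (F i)) /\
    (forall (i : 'I_k) (v : vertex G),
       `|(factor_degree (F i) v)%:R - eps i * (degree v)%:R| < 6).
Proof.
(* Only positive weights can be compared by ratios; colours of weight 0 get empty classes, with
   error 0. *)
pose A := [set i | 0 < eps i].
have epsA i : i \notin A -> eps i = 0.
  by rewrite inE lt0r eps_ge0 andbT => /negPn/eqP.
have sumA : \sum_(i in A) eps i = 1.
  rewrite -eps_sum [RHS](bigID (fun i => i \in A)) /= [X in _ + X]big1 ?addr0 //.
have A0 : A != set0.
  by apply: contra_eq_neq sumA => ->; rewrite big_set0 eq_sym oner_neq0.
have [i|v|col [colA colP]] := @proportional_coloring R G _ eps
    (fun v => (degree v)%:R) A [set: edge G] G_even A0.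
- by rewrite inE.
- by rewrite sumA mul1r.
have class0 i : i \notin A -> color_class [set: edge G] col i = set0.
  move=> iA; apply/setP => e; rewrite !inE; apply: contraNF iA => /eqP <-.
  exact: colA.
exists (color_class [set: edge G] col); split; [split|split].
- apply/setP => e; rewrite inE; apply/bigcupP; exists (col e) => //.
  by rewrite !inE eqxx.
- move=> i j ij; rewrite -setI_eq0; apply/eqP/setP => e; rewrite !inE /=.
  by apply: contraNF ij => /andP[/eqP<- /eqP<-].
- move=> i; have [/colP[]//|/class0->] := boolP (i \in A).
  by move=> v; rewrite /factor_degree big_set0.
- move=> i v; have [/colP[_]//|iA] := boolP (i \in A).
  by rewrite class0 // epsA // /factor_degree big_set0 mul0r subrr normr0.
Qed.
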